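(* Let $G\in\mathcal{G}_{n,d}$ and $H\in\mathcal{G}_{m,d}$, where $m=m(n)$, $n$ and $d=d(n)$ all tend to $\infty$ in such a way that $m\le n$ and $d=o(m^{1/2})$. Let $\epsilon>0$ be a constant, and let $\{\delta_m\}$ be a sequence of positive numbers such that $$\delta_m\gg\frac{2\sqrt{2e}}{d}\,m^{\frac12+\frac{4}{d+1}+\epsilon}.$$ Then there exists a constant $C$ such that $$\mathbb{P}\left(\gamma(G,d_H,f)\le C\ \text{ for all } f\in\mathcal{F}_{G,H}(\delta_m)\right)\to 1\quad\text{as } n\to\infty.$$
   Context: $\mathcal{G}_{n,d}$ denotes the uniform probability space of simple $d$-regular graphs on the vertex set $[n]=\{1,\dots,n\}$ ($nd$ and $md$ are assumed even); $G$ and $H$ are chosen independently. $a\gg b$ means $b=o(a)$; in the displayed condition $e$ is the base of the natural logarithm. For a connected graph $H$, $d_H$ is the usual graph distance on $V(H)$ (the event that $H$ is disconnected has probability tending to $0$ and may be counted as failure). For a $d$-regular graph $G$ on $n$ vertices and $f:V(G)\to V(H)$, $\gamma(G,d_H,f)$ is the number satisfying $$\frac{\gamma(G,d_H,f)}{dn}\sum_{u\sim_G v} d_H^2(f(u),f(v))=\frac{1}{n^2}\sum_{u,v\in V(G)}d_H^2(f(u),f(v)),$$ where the first sum is over edges $\{u,v\}$ of $G$ and the second over ordered pairs of vertices; the statement $\gamma(G,d_H,f)\le C$ means that $\frac{1}{n^2}\sum_{u,v\in V(G)}d_H^2(f(u),f(v))\le\frac{C}{dn}\sum_{u\sim_G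 v} d_H^2(f(u),f(v))$ (so it holds trivially for constant $f$). For $\delta>0$, $\mathcal{F}_{G,H}(\delta)$ is the class of functions $f:V(G)\to V(H)$ such that $|f^{-1}(i)|\le \frac{n}{\delta}$ for all $i\in V(H)$, where $n=|V(G)|$. *)

(* Defs.v *)
From mathcomp Require Import all_boot all_order all_algebra.
From mathcomp Require Import all_classical all_reals all_analysis.
Import Order.TTheory GRing.Theory Num.Theory.
Import numFieldNormedType.Exports.

Set Implicit Arguments.
Unset Strict Implicit.
Unset Printing Implicit Defensive.

Local Open Scope classical_set_scope.
Local Open Scope ring_scope.

(* A graph on the vertex set 'I_n is given by its edge set, a set of subsets
   of 'I_n; it is simple when all its edges have exactly two elements. *)
Notation edges_on n := {set {set 'I_n}}.

Definition simple n (G : edges_on n) : bool := [forall e in G, #|e| == 2%N].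

Definition adj n (G : edges_on n) : rel 'I_n := fun u v => [set u; v]%SET \in G.

Definition degree n (G : edges_on n) (v : 'I_n) : nat := #|[set w | adj G v w]%SET|.

Definition regular_graphs (n d : nat) : {set edges_on n} :=
  [set G : edges_on n | simple G && [forall v, degree G v == d]]%SET.

Definition connected_graph n (G : edges_on n) : bool :=
  [forall u, forall v, connect (adj G) u v].

(* The least length of a walk from x to y. A shortest walk has fewer than n
   edges, so the search range loses nothing; if x and y are not connected,
   the junk value is n. *)
Definition gdist n (G : edges_on n) (x y : 'I_n) : nat :=
  find (fun k => [exists p : k.-tuple 'I_n, path (adj G) x p && (last x p == y)])
       (iota 0 n).

(* Each edge {u, v} is counted once, through its representation with u < v. *)
Definition gamma_le (R : realType) n m (d : nat) (G : edges_on n) (H : edges_on m)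
    (f : {ffun 'I_n -> 'I_m}) (C : R) : bool :=
  (n%:R ^+ 2)^-1 * (\sum_(u < n) \sum_(v < n) (gdist H (f u) (f v))%:R ^+ 2)
  <= C / (d%:R * n%:R)
     * (\sum_(u < n) \sum_(v < n | (u < v)%N && adj G u v)
          (gdist H (f u) (f v))%:R ^+ 2).

Definition small_fibers (R : realType) n m (delta : R) : {set {ffun 'I_n -> 'I_m}} :=
  [set f : {ffun 'I_n -> 'I_m} |
    [forall i, #|[set v | f v == i]%SET|%:R <= n%:R / delta]]%SET.

(* The uniform probability on Omega of an event; it is 0 if Omega is empty. *)
Definition unif_prob (R : realType) (T : finType) (Omega : {set T}) (A : pred T) : R :=
  #|[set x in Omega | A x]%SET|%:R / #|Omega|%:R.

(* Independence of G and H amounts to the uniform law on the product of the two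
   sets of graphs. A disconnected H counts as failure. *)
Definition prob_gamma_le (R : realType) (n m d : nat) (delta C : R) : R :=
  unif_prob R (finset.setX (regular_graphs n d) (regular_graphs m d))
    (fun GH => connected_graph GH.2 &&
       [forall f in small_fibers n m delta, gamma_le d GH.1 GH.2 f C]).

(* n tends to infinity through the values for which n d(n) and m(n) d(n)
   are both even. *)
Definition admissible_oo (m d : nat -> nat) : set_system nat :=
  within [set n | ~~ odd (n * d n) /\ ~~ odd (m n * d n)] \oo.

(* Main.v *)
Require Import Defs.
From mathcomp Require Import all_boot all_order all_algebra.
From mathcomp Require Import reals.
From mathcomp Require Import zify ring lra.
Import Order.TTheory GRing.Theory Num.Theory.

(** With high probability, and simultaneously for all f, the mean of the squared
    distances over all pairs is at most, and their mean over the edges of G is at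
    least, a constant times (log_d m)^2.

    Upper bound for the mean over all pairs: H has diameter O(log_d m). Small
    sets of vertices of H expand by a factor of order d and any two large sets
    are joined by an edge (card_not_expander), so the balls around two vertices
    grow geometrically until they meet (diameter_le).

    Lower bound for the mean over the edges: let r be a small multiple of
    log_d m, chosen so that a ball of radius r in H has at most a small power of
    m vertices. Since the fibers of f have at most n / delta elements and delta
    is at least m^eps, the pairs {u, v} sent by f to within distance r form a set
    of at most n^2 m^(-a) pairs, for some a > 0 that depends on eps. The
    probability that half of the edges of G fall into so small a set is at most
    m^(-b d n) for some b > 0, and because d tends to infinity this beats the
    number m^n of functions f (card_not_spread). Outside this event at least
    n d / 4 edges of G are stretched to length more than r, whatever f is
    (gamma_le_spread).

    All probabilities are estimated by one bound, regular_edge_tail, on the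
    number of d-regular graphs that have many edges in a given set E of pairs.
    Replacing two edges uv, xy by ux, vy turns d-regular graphs that contain uv
    into d-regular graphs that do not, and counting these switchings shows that
    k given pairs are all edges with probability at most (c d / n)^k, for k a
    small part of n d; the first moment of the number of k-subsets of E contained
    in the graph then bounds the tail. This replaces the configuration model, whose simplicity
    probability would have to be controlled for d up to the square root of m.
    For the expansion of S, E is the set of pairs between S and its
    neighbourhood; for the edges between A and B, it is the complement of A x B;
    for f, it is the set of pairs with close images. *)

Set Implicit Arguments.
Unset Strict Implicit.
Unset Printing Implicit Defensive.

(** * Counting in finite sets *)

Lemma leq_card_bigcup (T I : finType) (J : pred I) (F : I -> {set T}) :
  #|\bigcup_(i | J i) F i| <= \sum_(i | J i) #|F i|.
Proof.
elim/big_rec2: _ => [|i s U _ le]; first by rewrite cards0.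
by rewrite (leq_trans (leq_card_setU _ _)) // leq_add2l.
Qed.

Lemma card_union_bound (T I : finType) (J : pred I) (A : {set T}) (P : I -> pred T) :
  #|[set x in A | [exists (i | J i), P i x]]| <= \sum_(i | J i) #|[set x in A | P i x]|.
Proof.
apply: (@leq_trans #|\bigcup_(i | J i) [set x in A | P i x]|).
  apply/subset_leq_card/subsetP => x; rewrite inE => /andP[xA /exists_inP[i Ji Pi]].
  by apply/bigcupP; exists i; rewrite // inE xA.
exact: leq_card_bigcup.
Qed.

Lemma leq_expn2r a b e : a <= b -> a ^ e <= b ^ e.
Proof. by case: e => // e ab; rewrite leq_exp2r. Qed.

(** * Edges and degrees *)

Lemma adjC n (G : edges_on n) : symmetric (adj G).
Proof. by move=> u v; rewrite /adj setUC. Qed.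

Lemma adj_irrefl n (G : edges_on n) : simple G -> irreflexive (adj G).
Proof.
move=> /forall_inP sG u; apply/negP => /sG.
by rewrite setUid cards1.
Qed.

Lemma set2_inj (T : finType) (v : T) : injective (fun w => [set v; w]).
Proof.
move=> w w' E; have : w \in [set v; w'] by rewrite -E set22.
rewrite !inE => /orP[/eqP wv|/eqP //]; subst w.
have : w' \in [set v; v] by rewrite E set22.
by rewrite !inE orbb => /eqP.
Qed.

Lemma simple_sub n (K G : edges_on n) : K \subset G -> simple G -> simple K.
Proof.
move=> /subsetP KG /forall_inP sG; apply/forall_inP => e /KG; exact: sG.
Qed.

Lemma degree_edges n (G : edges_on n) v : simple G ->
  degree G v = \sum_(e in G) (v \in e).
Proof.
move=> sG; rewrite -big_mkcondr /= sum1_card.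
rewrite /degree -(card_imset _ (@set2_inj _ v)); apply: eq_card => e.
apply/imsetP/idP => [[w]|].
  by rewrite inE => wG ->; apply/andP; split; rewrite ?set21.
move=> /andP[eG ve].
have /cards2P[x [y [xy E]]] : #|e| == 2 by move: e eG {ve}; apply/forall_inP.
move: ve eG; rewrite E !inE => /orP[/eqP->|/eqP->] G2.
  by exists y; rewrite ?inE.
by exists x; [rewrite inE adjC | rewrite setUC].
Qed.

Lemma handshake n (G : edges_on n) : simple G -> \sum_v degree G v = 2 * #|G|.
Proof.
move=> sG; under eq_bigr do rewrite degree_edges //.
rewrite exchange_big /= mulnC -sum_nat_const.
apply: eq_bigr => e eG; rewrite -(eqP (forall_inP sG e eG)).
by rewrite -sum1_card [RHS]big_mkcond; apply: eq_bigr => v _; case: (v \in e).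
Qed.

Definition arcs n (G : edges_on n) (A : {set 'I_n}) : {set 'I_n * 'I_n} :=
  [set p | (p.1 \in A) && adj G p.1 p.2].

Lemma card_arcs n (G : edges_on n) A : #|arcs G A| = \sum_(v in A) degree G v.
Proof.
rewrite -sum1_card.
under [RHS]eq_bigr do rewrite /degree -sum1dep_card.
rewrite pair_big_dep /=.
by apply: eq_bigl => p; rewrite inE.
Qed.

Lemma card_arcsT n (G : edges_on n) : simple G -> #|arcs G setT| = 2 * #|G|.
Proof.
move=> sG; rewrite card_arcs -handshake //.
by apply: eq_bigl => w; rewrite inE.
Qed.

Lemma regular_simple n d (G : edges_on n) : G \in regular_graphs n d -> simple G.
Proof. by rewrite inE => /andP[]. Qed.

Lemma regular_degree n d (G : edges_on n) v :
  G \in regular_graphs n d -> degree G v = d.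
Proof. by rewrite inE => /andP[_ /forallP/(_ v)/eqP]. Qed.

Lemma regular_card_arcs n d (G : edges_on n) A :
  G \in regular_graphs n d -> #|arcs G A| = #|A| * d.
Proof.
move=> GR; rewrite card_arcs -sum_nat_const.
by apply: eq_bigr => v _; rewrite (regular_degree v GR).
Qed.

Lemma regular_card n d (G : edges_on n) :
  G \in regular_graphs n d -> 2 * #|G| = n * d.
Proof.
move=> GR; rewrite -handshake ?(regular_simple GR) //.
under eq_bigr do rewrite (regular_degree _ GR).
by rewrite sum_nat_const card_ord.
Qed.

(** * Switchings *)

(** The classical switching of two edges, which preserves all degrees. *)
Definition switch n (G : edges_on n) (u v x y : 'I_n) : edges_on n :=
  [set u; x] |: ([set v; y] |: (G :\ [set u; v] :\ [set x; y])).

Definition closed_nbhd n (G : edges_on n) (u : 'I_n) : {set 'I_n} :=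
  u |: [set w | adj G u w].

Lemma card_closed_nbhd n d (G : edges_on n) u :
  G \in regular_graphs n d -> #|closed_nbhd G u| = d.+1.
Proof.
move=> GR; rewrite cardsU1 inE (adj_irrefl (regular_simple GR)).
by rewrite -/(degree G u) (regular_degree u GR).
Qed.

(** The arcs xy along which uv can be switched away without creating a double
    edge or a loop and without destroying an edge of K. *)
Definition switchable n (G K : edges_on n) (u v : 'I_n) : {set 'I_n * 'I_n} :=
  [set p in arcs G setT | [&& ~~ adj K p.1 p.2, p.1 \notin closed_nbhd G u &
                           p.2 \notin closed_nbhd G v]].

(** Of the n d arcs of G, those running along an edge of K, those starting next
    to u and those ending next to v are lost; there are 2|K|, d(d+1) and d(d+1)
    of them. *)
Lemma card_switchable n d (G K : edges_on n) u v :
  G \in regular_graphs n d -> K \subset G ->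
  n * d - 2 * #|K| - 2 * (d * d.+1) <= #|switchable G K u v|.
Proof.
move=> GR KG.
have KA : #|arcs K setT| = 2 * #|K|.
  by rewrite card_arcsT ?(simple_sub KG) ?(regular_simple GR).
pose A2 := [set p in arcs G setT | p.2 \in closed_nbhd G v].
have A2E : #|A2| = d.+1 * d.
  rewrite -(card_closed_nbhd v GR) -(regular_card_arcs _ GR).
  have swI : injective (fun p : 'I_n * 'I_n => (p.2, p.1)) by case=> a b [c e] [-> ->].
  rewrite -(card_imset _ swI); apply: eq_card => -[a b].
  apply/imsetP/idP => [[[c e]]|].
    by rewrite !inE /= => /andP[Nc ce] [-> ->]; rewrite (adjC G e) ce Nc.
  rewrite !inE /= => /andP[ab Nb]; exists (b, a) => //.
  by rewrite !inE /= (adjC G b a) ab Nb.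
have A1E := regular_card_arcs (closed_nbhd G u) GR.
rewrite (card_closed_nbhd u GR) in A1E.
have AE := regular_card_arcs setT GR; rewrite cardsT card_ord in AE.
have : arcs G setT \subset
   switchable G K u v :|: arcs K setT :|: arcs G (closed_nbhd G u) :|: A2.
  apply/subsetP => -[a b]; rewrite !inE /= => ->.
  by case: (adj K a b); case: ((a == u) || _); case: ((b == v) || _).
move=> /subset_leq_card; rewrite AE => le.
have := leq_card_setU (switchable G K u v :|: arcs K setT :|: arcs G (closed_nbhd G u)) A2.
have := leq_card_setU (switchable G K u v :|: arcs K setT) (arcs G (closed_nbhd G u)).
have := leq_card_setU (switchable G K u v) (arcs K setT).
move=> [l1 _] [l2 _] [l3 _].
rewrite KA in l1; rewrite A1E in l2; rewrite A2E in l3.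
lia.
Qed.

Lemma in_set2_sum (T : finType) (a b z : T) : a != b ->
  (z \in [set a; b]) = (z == a) + (z == b) :> nat.
Proof.
move=> ab; rewrite !inE; have [->|//] := eqVneq z a.
by rewrite (negPf ab).
Qed.

Lemma switchable_neq n (G K : edges_on n) (u v x y : 'I_n) :
  simple G -> adj G u v -> (x, y) \in switchable G K u v ->
  [/\ [&& u != v, x != y, x != u, x != v, y != u & y != v],
      [set x; y] \in G :\: K, [set u; x] \notin G & [set v; y] \notin G].
Proof.
move=> sG uv; rewrite !inE /= !negb_or => /and4P[xy xyK /andP[xu ux] /andP[yv vy]].
split=> //; last by rewrite xyK.
rewrite xu yv /=; have irr := adj_irrefl sG.
apply/and4P; split; first by apply/eqP => E; rewrite E irr in uv.
- by apply/eqP => E; rewrite E irr in xy.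
- by apply: contraNneq ux => ->.
- by rewrite andbT; apply: contraNneq vy => ->; rewrite adjC.
Qed.

Lemma set2_neq (T : finType) (a b c e : T) :
  a != c -> a != e -> [set a; b] != [set c; e].
Proof.
move=> ac ae; apply/eqP => E; have : a \in [set c; e] by rewrite -E set21.
by rewrite !inE (negPf ac) (negPf ae).
Qed.

Lemma switch_regular n d (G K : edges_on n) (u v x y : 'I_n) :
  G \in regular_graphs n d -> adj G u v -> (x, y) \in switchable G K u v ->
  switch G u v x y \in regular_graphs n d.
Proof.
move=> GR uv /(switchable_neq (regular_simple GR) uv).
case=> /and5P[nuv nxy nxu nxv /andP[nyu nyv]] /setDP[xy _] ux vy.
have sG := regular_simple GR.
have sS : simple (switch G u v x y).
  apply/forall_inP => e; rewrite !inE => /or3P[/eqP->|/eqP->|/and3P[_ _]].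
  - by rewrite cards2 [u == x]eq_sym nxu.
  - by rewrite cards2 [v == y]eq_sym nyv.
  - by move: e; apply/forall_inP.
rewrite inE sS; apply/forallP => z.
rewrite -(regular_degree z GR) !degree_edges //.
have n1 : [set x; y] != [set u; v] by rewrite set2_neq.
have n2 : [set u; x] != [set v; y] by rewrite set2_neq // eq_sym.
rewrite /switch big_setU1 /=; last by rewrite !inE (negPf n2) (negPf ux) !andbF.
rewrite big_setU1 /=; last by rewrite !inE (negPf vy) !andbF.
rewrite [X in _ == X](big_setD1 [set u; v]) //= [X in _ == _ + X](big_setD1 [set x; y]) /=; last first.
  by rewrite !inE n1 xy.
rewrite !in_set2_sum ?[u == x]eq_sym ?[v == y]eq_sym //.
apply/eqP; rewrite !addnA; congr addn.
by congr addn; rewrite addnAC.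
Qed.

Definition regular_above n d (K : edges_on n) : {set edges_on n} :=
  [set G in regular_graphs n d | K \subset G].

(** Double counting of the switchings that destroy e = uv. A graph above K admits
    many of them, one for each switchable arc, whereas the graph obtained
    determines the original one as soon as the neighbours x of u and y of v that
    were used are known, which leaves d^2 possibilities. *)
Lemma card_regular_above_switch n d (K : edges_on n) e : e \in K ->
  #|regular_above d K| * (n * d - 2 * #|K| - 2 * (d * d.+1))
    <= #|regular_above d (K :\ e)| * (d * d).
Proof.
move=> eK; have [->|[G0]] := set_0Vmem (regular_above d K).
  by rewrite cards0.
rewrite inE => /andP[G0R KG0].
have e2 : #|e| == 2.
  by move: (subsetP KG0 _ eK); move: e {eK}; apply/forall_inP/(regular_simple G0R).
have /cards2P[u [v [_ E]]] := e2.
pose P := [set q : edges_on n * ('I_n * 'I_n) |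
            (q.1 \in regular_above d K) && (q.2 \in switchable q.1 K u v)].
pose Q := [set q : edges_on n * ('I_n * 'I_n) |
   (q.1 \in regular_above d (K :\ e)) &&
     ((adj q.1 u q.2.1) && (adj q.1 v q.2.2))].
have Pfact q : q \in P -> [/\ q.1 \in regular_graphs n d, K \subset q.1, adj q.1 u v &
    (q.2.1, q.2.2) \in switchable q.1 K u v].
  rewrite inE => /andP[]; rewrite inE => /andP[qR Kq] sw; split=> //.
    by rewrite /adj -E (subsetP Kq).
  by rewrite -surjective_pairing.
pose phi (q : edges_on n * ('I_n * 'I_n)) := (switch q.1 u v q.2.1 q.2.2, q.2).
(* psi undoes the switching. *)
pose psi (q : edges_on n * ('I_n * 'I_n)) :=
  ([set u; v] |: ([set q.2.1; q.2.2] |: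
     (q.1 :\ [set u; q.2.1] :\ [set v; q.2.2])), q.2).
have phiK : {in P, cancel phi psi}.
  move=> [G [x y]] /Pfact[/= GR KG uv sw].
  have [_ /setDP[xy _] ux vy] := switchable_neq (regular_simple GR) uv sw.
  congr pair; apply/setP => f; rewrite !inE /=.
  have [->|fuv] := eqVneq f [set u; v]; first by rewrite /= -/(adj G u v) uv.
  have [->|fxy] := eqVneq f [set x; y]; first by rewrite /= xy.
  have [->|fvy] /= := eqVneq f [set v; y]; first by rewrite (negPf vy).
  by have [->|fux] /= := eqVneq f [set u; x]; rewrite ?(negPf ux).
have phiQ : phi @: P \subset Q.
  apply/subsetP => q' /imsetP[[G [x y]] /Pfact[/= GR KG uv sw] ->].
  have [_ /setDP[xy xyK] ux vy] := switchable_neq (regular_simple GR) uv sw.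
  rewrite inE /=; apply/andP; split; last first.
    by rewrite /adj /switch !in_setU1 !eqxx !orbT.
  rewrite inE (switch_regular GR uv sw) /=.
  apply/subsetP => f; rewrite !inE -E => /andP[-> fK].
  rewrite (subsetP KG _ fK) !andbT; apply/orP; right; apply/orP; right.
  by apply: contraNneq xyK => <-.
have QE : #|Q| = #|regular_above d (K :\ e)| * (d * d).
  rewrite -sum1_card.
  under eq_bigl => q do rewrite inE.
  rewrite -(pair_big_dep (fun G => G \in regular_above d (K :\ e))
     (fun G (p : 'I_n * 'I_n) => adj G u p.1 && adj G v p.2) (fun _ _ => 1)) /=.
  rewrite -sum_nat_const; apply: eq_bigr => G; rewrite inE => /andP[GR _].
  transitivity (degree G u * degree G v); last by rewrite !(regular_degree _ GR).
  rewrite sum1dep_card -cardsX; apply: eq_card => p.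
  by rewrite !inE.
have PE : #|regular_above d K| * (n * d - 2 * #|K| - 2 * (d * d.+1)) <= #|P|.
  rewrite -[#|P|]sum1_card.
  under [X in _ <= X]eq_bigl => q do rewrite inE.
  rewrite -(pair_big_dep (fun G => G \in regular_above d K)
     (fun G p => p \in switchable G K u v) (fun _ _ => 1)) /=.
  rewrite -sum_nat_const; apply: leq_sum => G; rewrite inE => /andP[GR KG].
  by rewrite sum1_card card_switchable.
by rewrite -QE (leq_trans PE) // -(card_in_imset (can_in_inj phiK)) subset_leq_card.
Qed.

(** * The upper tail of the number of edges in a set of pairs *)

(** Removing the edges of K one at a time: a random d-regular graph contains K
    with probability at most (d^2 / (n d - 2k - 2d(d+1)))^|K|, which is of the
    order of (d/n)^|K| as long as k is a small part of n d. *)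
Lemma card_regular_above n d k (K : edges_on n) : #|K| <= k ->
  #|regular_above d K| * (n * d - 2 * k - 2 * (d * d.+1)) ^ #|K|
    <= #|regular_graphs n d| * (d * d) ^ #|K|.
Proof.
move: {2}#|K| (erefl #|K|) => j; elim: j K => [|j IH] K Kj Kk.
  by rewrite Kj !muln1 subset_leq_card //; apply/subsetP => G; rewrite inE => /andP[].
have [e eK] : exists e, e \in K by apply/set0Pn; rewrite -card_gt0 Kj.
have K'j : #|K :\ e| = j by move: (cardsD1 e K); rewrite eK; lia.
have {IH} := IH _ K'j; rewrite K'j Kj => /(_ ltac:(lia)) IH.
have := @card_regular_above_switch n d K e eK.
move: IH; set D := (n * d - 2 * k - 2 * (d * d.+1)).
have : D <= n * d - 2 * #|K| - 2 * (d * d.+1) by rewrite /D; lia.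
set D' := (_ - _ - _) => DD' IH sw; rewrite !expnS.
apply: (@leq_trans (#|regular_above d (K :\ e)| * (d * d) * D ^ j)).
  by rewrite mulnA leq_mul2r (leq_trans _ sw) ?orbT // leq_mul2l DD' orbT.
by rewrite mulnAC [X in _ <= X]mulnCA [X in _ <= X]mulnC leq_mul2r IH orbT.
Qed.

Lemma expn_sub_leq_ffact x k : (x - k) ^ k <= x ^_ k.
Proof.
suff H j : j <= k -> (x - k) ^ j <= x ^_ j by exact: H.
elim: j => // j IH jk; rewrite expnSr ffactnSr leq_mul ?IH ?(ltnW jk) //; lia.
Qed.

Lemma ffact_leq_expn x k : x ^_ k <= x ^ k.
Proof. by elim: k => // k IH; rewrite ffactnSr expnSr leq_mul // leq_subr. Qed.

(** The estimate behind every probabilistic step. A graph with at least x edges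
    in E contains at least 'C(x, k) of the 'C(|E|, k) sets of k pairs from E, so
    the first moment of the number of these sets gives the bound; the ratio of
    the two binomials is at most (|E| / (x - k))^k. The free parameter k is to
    be large enough for the power to beat a union bound, and small compared with
    x and n d. *)
Lemma regular_edge_tail n d (E : edges_on n) x k :
  #|[set G in regular_graphs n d | x <= #|G :&: E| ]|
      * ((x - k) * (n * d - 2 * k - 2 * (d * d.+1))) ^ k
    <= #|regular_graphs n d| * (#|E| * (d * d)) ^ k.
Proof.
set bad := [set G in _ | _]; set D := n * d - _ - _.
pose Ks := [set K : edges_on n | (K \subset E) && (#|K| == k)].
have count : #|bad| * 'C(x, k) <= \sum_(K in Ks) #|regular_above d K|.
  under [X in _ <= X]eq_bigr do rewrite -sum1_card.
  rewrite (exchange_big_dep (mem (regular_graphs n d))) /=; last first.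
    by move=> K G _; rewrite inE => /andP[].
  rewrite (bigID (fun G => x <= #|G :&: E|)) /= -sum_nat_const.
  apply: leq_trans (leq_addr _ _).
  rewrite [X in X <= _](eq_bigl (fun G =>
    (G \in regular_graphs n d) && (x <= #|G :&: E|))); last by move=> G; rewrite inE.
  apply: leq_sum => G /andP[GR xG]; rewrite sum1dep_card.
  apply: leq_trans (leq_bin2l _ xG) _; rewrite -cards_draws subset_leq_card //.
  apply/subsetP => K; rewrite !inE subsetI => /andP[/andP[KG KE] Kk].
  by rewrite KE Kk /= (_ : _ && _) //; move: GR; rewrite inE => ->.
have union : #|bad| * 'C(x, k) * D ^ k <= 'C(#|E|, k) * (#|regular_graphs n d| * (d * d) ^ k).
  apply: leq_trans (leq_mul count (leqnn _)) _.
  rewrite -cards_draws -/Ks -sum_nat_const big_distrl /=.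
  apply: leq_sum => K; rewrite inE => /andP[_ /eqP Kk].
  by move: (@card_regular_above n d k K); rewrite Kk => /(_ (leqnn k)).
rewrite (expnMn (x - k)) (expnMn #|E|).
apply: (@leq_trans (#|bad| * (x ^_ k * D ^ k))).
  by apply: leq_mul => //; apply: leq_mul => //; exact: expn_sub_leq_ffact.
apply: (@leq_trans (#|regular_graphs n d| * (#|E| ^_ k * (d * d) ^ k))); last first.
  by apply: leq_mul => //; apply: leq_mul => //; exact: ffact_leq_expn.
rewrite -!bin_ffact.
have := leq_mul union (leqnn (k`!)).
move: (D ^ k) ((d * d) ^ k) => a b.
rewrite -[_ * a * k`!]mulnA (mulnC a) (mulnCA 'C(#|E|, k)) -[_ * k`!]mulnA.
by rewrite -[_ * b * k`!]mulnA (mulnC b) !mulnA.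
Qed.

(** * Existence of regular graphs *)

Definition circulant n (S : {set 'I_n.+1}) : edges_on n.+1 :=
  [set [set u; (u + s)%R] | u in 'I_n.+1, s in S].

Lemma adj_circulant n (S : {set 'I_n.+1}) u v : (forall s, s \in S -> (- s)%R \in S) ->
  adj (circulant S) u v = ((v - u)%R \in S).
Proof.
move=> Sopp; apply/imset2P/idP => [[a s _ sS E]|vuS]; last first.
  by exists u (v - u)%R => //; rewrite addrC subrK.
have [ua|va] := eqVneq u a.
  by rewrite ua in E *; rewrite (set2_inj E) addrC addKr.
have : u \in [set a; (a + s)%R] by rewrite -E set21.
rewrite !inE (negPf va) => /eqP ua; rewrite {u}ua [RHS]setUC in va E *.
rewrite (set2_inj E) opprD addrA subrr sub0r.
exact: Sopp.
Qed.

Lemma circulant_regular n (S : {set 'I_n.+1}) :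
  (forall s, s \in S -> (- s)%R \in S) -> 0%R \notin S ->
  circulant S \in regular_graphs n.+1 #|S|.
Proof.
move=> Sopp S0; rewrite inE; apply/andP; split.
  apply/forall_inP => _ /imset2P[u s _ sS ->]; rewrite cards2.
  suff -> : u != (u + s)%R by [].
  apply: contraNneq S0 => us; rewrite (_ : 0%R = s) //.
  by apply: (@addrI _ u); rewrite addr0.
apply/forallP => u; rewrite -(card_imset S (@addrI _ u)).
apply/eqP/eq_card => w; rewrite inE adj_circulant //.
apply/idP/imsetP => [wuS|[s sS ->]]; last by rewrite addrC addKr.
by exists (w - u)%R => //; rewrite addrC subrK.
Qed.

Definition cyc_interval n e : {set 'I_n.+1} := [set s : 'I_n.+1 | (0 < s) && ((s <= e) || (n < s + e))].

Lemma card_cyc_interval n e : 2 * e <= n -> #|cyc_interval n e| = 2 * e.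
Proof.
elim: e => [_|e IH en].
  by apply: eq_card0 => s; rewrite !inE addn0; move: (ltn_ord s); lia.
have -> : cyc_interval n e.+1 = inord e.+1 |: (inord (n - e) |: cyc_interval n e).
  apply/setP => s; rewrite !inE -!val_eqE /= !inordK; [|lia|lia].
  by move: (ltn_ord s); lia.
rewrite !cardsU1 IH ?inE -?val_eqE /= ?inordK; lia.
Qed.

Lemma cyc_intervalN n e (s : 'I_n.+1) :
  s \in cyc_interval n e -> (- s)%R \in cyc_interval n e.
Proof.
rewrite !inE /= => /andP[s0]; have := ltn_ord s.
by rewrite modn_small; lia.
Qed.

(** Circulant graphs: joining each vertex of Z_n to the d./2 nearest ones on
    both sides gives an even degree; when d is odd, n is even and the antipodal
    vertex supplies the missing neighbour. *)
Lemma regular_graphs_neq0 n d : d < n -> ~~ odd (n * d) -> 0 < #|regular_graphs n d|.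
Proof.
case: n => // n dn nd_even; apply/card_gt0P.
have [dE|dO] := boolP (odd d); last first.
  have dd : 2 * d./2 = d by lia.
  exists (circulant (cyc_interval n d./2)); rewrite -{2}dd -(@card_cyc_interval n); last lia.
  by apply: circulant_regular; [exact: cyc_intervalN | rewrite !inE].
have dd : 2 * d./2 = d.-1 by lia.
have nE : odd n by move: nd_even; rewrite oddM dE andbT /= negbK.
pose h : 'I_n.+1 := inord n.+1./2.
have hE : h = n.+1./2 :> nat by rewrite inordK; lia.
have Nh : h \notin cyc_interval n d./2 by rewrite inE hE; lia.
exists (circulant (h |: cyc_interval n d./2)).
have cardS : #|h |: cyc_interval n d./2| = d by rewrite cardsU1 Nh card_cyc_interval; lia.
rewrite -[X in regular_graphs _ X]cardS; apply: circulant_regular => [s|]; last first.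
  by rewrite !inE orbF; apply/eqP => /(congr1 val) /=; rewrite hE; lia.
case/setU1P => [->|/cyc_intervalN sI]; apply/setU1P; [left|by right].
by apply/val_inj; rewrite /= hE modn_small; lia.
Qed.

(** * Balls, distances and the diameter of expanders *)

Definition nbhd n (G : edges_on n) (S : {set 'I_n}) : {set 'I_n} :=
  \bigcup_(s in S) closed_nbhd G s.

Definition gball n (G : edges_on n) (k : nat) (x : 'I_n) : {set 'I_n} :=
  iter k (nbhd G) [set x].

Lemma closed_nbhdC n (G : edges_on n) u v :
  (u \in closed_nbhd G v) = (v \in closed_nbhd G u).
Proof. by rewrite !inE adjC eq_sym. Qed.

Lemma card_nbhd n d (G : edges_on n) S :
  G \in regular_graphs n d -> #|nbhd G S| <= #|S| * d.+1.
Proof.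
move=> GR; rewrite -sum_nat_const.
under [X in _ <= X]eq_bigr => s _ do rewrite -(card_closed_nbhd s GR).
exact: leq_card_bigcup.
Qed.

Lemma card_gball n d (G : edges_on n) k x :
  G \in regular_graphs n d -> #|gball G k x| <= d.+1 ^ k.
Proof.
move=> GR; elim: k => [|k IH]; first by rewrite cards1.
by rewrite expnSr (leq_trans (card_nbhd _ GR)) // leq_mul2r IH orbT.
Qed.

Lemma sub_nbhd n (G : edges_on n) (S : {set 'I_n}) : S \subset nbhd G S.
Proof. by apply/subsetP => s sS; apply/bigcupP; exists s; rewrite ?setU11. Qed.

Lemma iter_nbhdS n (G : edges_on n) (S T : {set 'I_n}) k :
  S \subset T -> iter k (nbhd G) S \subset iter k (nbhd G) T.
Proof.
move=> ST; elim: k => //= k IH; apply/bigcupsP => s sk.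
by apply: (bigcup_max s) => //; apply: (subsetP IH).
Qed.

Lemma gball_trans n (G : edges_on n) i j x y z :
  z \in gball G i x -> y \in gball G j z -> y \in gball G (j + i) x.
Proof.
move=> zi yj; rewrite /gball iterD.
by apply: (subsetP (iter_nbhdS _ _ _)) yj; rewrite sub1set.
Qed.

Lemma gball1 n (G : edges_on n) x : gball G 1 x = closed_nbhd G x.
Proof. exact: big_set1. Qed.

Lemma gball_sym n (G : edges_on n) k x y : (y \in gball G k x) = (x \in gball G k y).
Proof.
suff sym a b : a \in gball G k b -> b \in gball G k a by apply/idP/idP; exact: sym.
elim: k a b => [|k IH] a b; first by rewrite !inE eq_sym.
case/bigcupP => z /IH zb; rewrite closed_nbhdC -gball1 => za.
by rewrite -addn1; apply: gball_trans za zb.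
Qed.

Lemma gball_walk n (G : edges_on n) k x y : y \in gball G k x ->
  exists2 p : seq 'I_n, path (adj G) x p /\ last x p = y & size p <= k.
Proof.
elim: k y => [|k IH] y; first by rewrite inE => /eqP ->; exists [::].
case/bigcupP => z /IH[p [xp pz] pk]; rewrite !inE => /orP[/eqP->|zy].
  by exists p; rewrite ?(leq_trans pk).
by exists (rcons p y); rewrite ?size_rcons // rcons_path last_rcons xp pz zy.
Qed.

Lemma walk_gball n (G : edges_on n) x p : path (adj G) x p ->
  last x p \in gball G (size p) x.
Proof.
elim/last_ind: p => [|p y IH] /=; first by rewrite inE.
rewrite rcons_path last_rcons size_rcons => /andP[/IH xp py].
by apply/bigcupP; exists (last x p); rewrite // !inE py orbT.
Qed.

(** A walk with n edges or more is covered by the default value n of the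
    distance. *)
Lemma gdist_le n (G : edges_on n) k x y : y \in gball G k x -> gdist G x y <= k.
Proof.
case/gball_walk => p [xp py] pk; apply: leq_trans pk; rewrite /gdist.
case: (ltnP (size p) n) => pn; last first.
  by apply: leq_trans (find_size _ _) _; rewrite size_iota.
rewrite leqNgt; apply/negP => /(before_find 0) /=; rewrite nth_iota //.
by move=> /existsP[]; exists (in_tuple p); rewrite /= xp py eqxx.
Qed.

Lemma gball_gdist n (G : edges_on n) k x y :
  k < n -> gdist G x y <= k -> y \in gball G k x.
Proof.
move=> kn dk; have dn : gdist G x y < n by exact: leq_ltn_trans kn.
have : has (fun k => [exists p : k.-tuple 'I_n, path (adj G) x p && (last x p == y)])
       (iota 0 n) by rewrite has_find size_iota.
move=> /(nth_find 0); rewrite -/(gdist G x y) nth_iota // add0n.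
case/existsP => p /andP[/walk_gball xp /eqP py]; rewrite py size_tuple in xp.
rewrite -(subnK dk) /gball iterD.
suff /subsetP : gball G (gdist G x y) x \subset iter (k - gdist G x y) (nbhd G) (gball G (gdist G x y) x).
  exact.
elim: (k - _) => //= i IH; exact: subset_trans IH (sub_nbhd _ _).
Qed.

Lemma connected_gball n (G : edges_on n) k :
  (forall x y, y \in gball G k x) -> connected_graph G.
Proof.
move=> Gk; apply/forallP => x; apply/forallP => y.
by have [p [xp <-] _] := gball_walk (Gk x y); apply/connectP; exists p.
Qed.

Definition expands m (d : nat) (G : edges_on m) : bool :=
  [forall S : {set 'I_m}, (S != set0) && (64 * #|nbhd G S| <= m) ==>
    (d * #|S| < 16 * #|nbhd G S|)].

(** The substitute for expansion at large scale: two sets that each fill a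
    64th of the graph meet or are joined by an edge. *)
Definition joins_large m (G : edges_on m) : bool :=
  [forall A : {set 'I_m}, forall B : {set 'I_m},
    (m < 64 * #|A|) && (m < 64 * #|B|) ==> (nbhd G A :&: B != set0)].

(** Expansion by the factor d / 16, which is at least the square root of d,
    makes a ball of radius k have at least d^(k/2) vertices until it fills a
    64th of the graph. *)
Lemma gball_large m d (G : edges_on m) l x :
  256 <= d -> m < d ^ l.+1 -> expands d G -> m < 64 * #|gball G (2 * l.+1) x|.
Proof.
move=> d256 ml Gexp.
have grow k : m < 64 * #|gball G k x| \/ d ^ k <= #|gball G k x| ^ 2.
  elim: k => [|k [IH|IH]]; first by right; rewrite cards1.
  - left; apply: leq_trans IH _; rewrite leq_mul2l /=.
    by apply: subset_leq_card; exact: sub_nbhd.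
  - case: (leqP (64 * #|gball G k.+1 x|) m) => [le|]; [right|by left].
    have nz : gball G k x != set0.
      by apply: contraTneq IH => ->; rewrite cards0 -ltnNge expn_gt0; lia.
    have := implyP (forallP Gexp (gball G k x)) _; rewrite nz -/(gball G k.+1 x) expnS.
    move=> /(_ le).
    move: IH; move: (d ^ k) (#|gball G k x|) (#|gball G k.+1 x|) => D a b.
    nia.
have [//|] := grow (2 * l.+1).
rewrite mulnC expnM leq_exp2r // => le.
by have := leq_trans ml (leq_trans le (max_card _)); rewrite card_ord ltnn.
Qed.

(** Balls of radius about 2 log_d m about any two points fill a positive
    proportion of the graph, so an edge leads from one to the other. *)
Lemma diameter_le m d (G : edges_on m) l x y :
  256 <= d -> m < d ^ l.+1 -> expands d G -> joins_large G ->
  y \in gball G (4 * l.+1).+1 x.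
Proof.
move=> d256 ml Gexp Gj.
have := implyP (forallP (forallP Gj (gball G (2 * l.+1) x)) (gball G (2 * l.+1) y)).
rewrite !(gball_large _ d256 ml Gexp) => /(_ isT)/set0Pn[b /setIP[bx]].
rewrite gball_sym => yb; rewrite (_ : (4 * l.+1).+1 = 2 * l.+1 + (2 * l.+1).+1); last by lia.
exact: gball_trans yb.
Qed.

(** * Random regular graphs are expanders *)

Definition pairs_between n (S T : {set 'I_n}) : edges_on n :=
  [set [set x; y] | x in S, y in T].

Lemma card_pairs_between n (S T : {set 'I_n}) : #|pairs_between S T| <= #|S| * #|T|.
Proof.
by rewrite /pairs_between curry_imset2X (leq_trans (leq_imset_card _ _)) // cardsX.
Qed.

Lemma card_arcs_sub n (G K : edges_on n) (S : {set 'I_n}) : simple K ->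
  {in S, forall u v, adj G u v -> adj K u v} -> #|arcs G S| <= 2 * #|K|.
Proof.
move=> sK GK; rewrite -card_arcsT //; apply/subset_leq_card/subsetP => -[u v].
by rewrite !inE /= => /andP[/GK]; apply.
Qed.

(** This is 'C(m, t) <= (4 m / t)^t. In place of Stirling's formula: t^t is at
    most (2t)^_t = 'C(2t, t) t!, and 'C(2t, t) is at most 4^t. *)
Lemma bin_mul_expn_le m t : 'C(m, t) * t ^ t <= (4 * m) ^ t.
Proof.
have tt : t ^ t <= 4 ^ t * t`!.
  have := expn_sub_leq_ffact (2 * t) t; rewrite -bin_ffact => le.
  have -> : t ^ t = (2 * t - t) ^ t by congr (_ ^ _); lia.
  apply: leq_trans le _; rewrite leq_mul2r; apply/orP; right.
  rewrite (_ : 4 = 2 ^ 2) // -expnM -[2 in X in _ <= X]/(1 + 1) expnDn.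
  have lt : t < (2 * t).+1 by lia.
  rewrite (bigD1 (Ordinal lt)) //= !exp1n !muln1 leq_addr //.
apply: leq_trans (leq_mul (leqnn _) tt) _.
by rewrite mulnCA bin_ffact expnMn leq_mul2l ffact_leq_expn orbT.
Qed.

(** If the neighbourhood of S lies in T, the d|S|/2 or more edges that touch S
    all belong to the |S||T| pairs between S and T, although such a set of
    pairs would typically hold only d|S||T|/m edges. The tail bound is used
    with k = 4|T|, which is at most half of the number of these edges, so the
    probability is at most (8|T|/m)^(4|T|). *)
Lemma card_confined_pair m d (S T : {set 'I_m}) :
  16 * d.+1 <= m -> 0 < d -> 64 * #|T| <= m -> 0 < #|S| -> 16 * #|T| <= d * #|S| ->
  #|[set G in regular_graphs m d | nbhd G S \subset T]| * m ^ (4 * #|T|)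
    <= #|regular_graphs m d| * (8 * #|T|) ^ (4 * #|T|).
Proof.
move=> dm d0 Tm S0 TS; set N := #|regular_graphs m d|; set bad := [set G in _ | _].
set s := #|S| in TS S0 *; set t := #|T| in Tm TS *.
(* At least x edges touch S, since each carries at most two arcs from S. *)
pose x := uphalf (d * s); pose D := m * d - 2 * (4 * t) - 2 * (d * d.+1).
have badP : bad \subset [set G in regular_graphs m d | x <= #|G :&: pairs_between S T|].
  apply/subsetP => G /setIdP[GR /subsetP ST]; apply/setIdP; split=> //.
  have : #|arcs G S| <= 2 * #|G :&: pairs_between S T|.
    apply: card_arcs_sub => [|u uS v uv].
      exact: simple_sub (subsetIl _ _) (regular_simple GR).
    rewrite /adj in_setI -/(adj G u v) uv /=; apply/imset2P; exists u v => //; apply: ST.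
    by apply/bigcupP; exists u; rewrite // !inE uv orbT.
  by rewrite (regular_card_arcs S GR) -/s /x; lia.
have := @regular_edge_tail m d (pairs_between S T) x (4 * t).
rewrite -/D -/N => tail.
have st := card_pairs_between S T; rewrite -/s -/t in st.
have x4 : d * s <= 4 * (x - 4 * t) by rewrite /x; lia.
have D2 : m * d <= 2 * D by rewrite /D; nia.
have pos : 0 < (s * d * d) ^ (4 * t) by rewrite expn_gt0 !muln_gt0 S0 d0.
rewrite -(leq_pmul2r pos).
apply: (@leq_trans (#|bad| * ((x - 4 * t) * D) ^ (4 * t) * 8 ^ (4 * t))).
  rewrite -!mulnA -!expnMn leq_mul2l leq_expn2r ?orbT //.
  have := leq_mul x4 D2; lia.
have {}tail := leq_trans (leq_mul (subset_leq_card badP) (leqnn _)) tail.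
apply: leq_trans (leq_mul tail (leqnn _)) _.
rewrite -!mulnA -!expnMn leq_mul2l; apply/orP; right.
apply: leq_expn2r.
have := leq_mul st (leqnn (d * d * 8)); lia.
Qed.

Lemma card_subset_pairs (T : finType) t :
  #|[set q : {set T} * {set T} | (#|q.1| == t) && (q.2 \subset q.1)]|
    = 'C(#|T|, t) * 2 ^ t.
Proof.
rewrite -sum1dep_card -(pair_big_dep (fun A : {set T} => #|A| == t)
  (fun A (B : {set T}) => B \subset A) (fun _ _ => 1)) /=.
rewrite -card_draws -sum_nat_const [RHS](eq_bigl (fun A : {set T} => #|A| == t)).
  apply: eq_bigr => A /eqP <-; rewrite -card_powerset -sum1_card.
  by apply: eq_bigl => B; rewrite inE.
by move=> A; rewrite inE.
Qed.

Definition confined_pair m d t (q : {set 'I_m} * {set 'I_m}) : bool :=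
  [&& #|q.1| == t, q.2 \subset q.1, 0 < #|q.2| & 16 * t <= d * #|q.2|].

(** The 'C(m, t) 2^t choices of T and of S inside T cost (8m/t)^t. Against
    (8t/m)^(4t) this leaves (8^5 (t/m)^3)^t, at most 8^(-t) because t is at most
    m/64. *)
Lemma card_confined m d t : 16 * d.+1 <= m -> 0 < d -> 0 < t -> 64 * t <= m ->
  #|[set G in regular_graphs m d |
      [exists (q : {set 'I_m} * {set 'I_m} | confined_pair d t q), nbhd G q.2 \subset q.1]]|
    * 8 ^ t <= #|regular_graphs m d|.
Proof.
move=> dm d0 t0 tm; set bad := [set G in _ | _]; set N := #|regular_graphs m d|.
pose J := @confined_pair m d t.
have pairs : #|[set q | J q]| <= 'C(m, t) * 2 ^ t.
  rewrite -[m in 'C(m, t)]card_ord -card_subset_pairs; apply/subset_leq_card/subsetP => q.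
  by rewrite !inE => /and4P[-> ->].
have union : #|bad| * m ^ (4 * t) <= 'C(m, t) * 2 ^ t * (N * (8 * t) ^ (4 * t)).
  apply: leq_trans (leq_mul (card_union_bound _ _ _) (leqnn _)) _.
  rewrite big_distrl /= -/J.
  apply: (@leq_trans (\sum_(q | J q) N * (8 * t) ^ (4 * t))); last first.
    by rewrite sum_nat_cond_const leq_mul2r pairs orbT.
  apply: leq_sum => q /and4P[/eqP qt _ q0 td].
  by have := @card_confined_pair m d q.2 q.1 dm d0; rewrite qt; apply.
have m0 : 0 < m by lia.
have pos : 0 < t ^ t * m ^ (4 * t) by rewrite muln_gt0 !expn_gt0 t0 m0.
rewrite -(leq_pmul2r pos).
apply: (@leq_trans (N * ((4 * m) ^ t * 2 ^ t * 8 ^ t * (8 * t) ^ (4 * t)))).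
  apply: (@leq_trans ('C(m, t) * t ^ t * (2 ^ t * 8 ^ t * (N * (8 * t) ^ (4 * t))))).
    have := leq_mul union (leqnn (8 ^ t * t ^ t)).
    move: (m ^ _) ((8 * t) ^ _) (2 ^ t) (8 ^ t) (t ^ t) => a b c e g; lia.
  apply: leq_trans (leq_mul (bin_mul_expn_le m t) (leqnn _)) _.
  rewrite leq_eqVlt; apply/orP; left; apply/eqP.
  move: (_ ^ t) (2 ^ t) (8 ^ t) ((8 * t) ^ _) => a b c e; ring.
rewrite leq_mul2l; apply/orP; right.
rewrite !expnM -!expnMn leq_expn2r //.
have : (64 * t) ^ 3 <= m ^ 3 by rewrite leq_expn2r.
move=> /leq_mul/(_ (leqnn (t * m))); rewrite !expnS !expn0 !muln1; lia.
Qed.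

Lemma geometric_sum_le (c : nat -> nat) N M :
  (forall t, t < M -> c t * 2 ^ t.+1 <= N) -> \sum_(t < M) c t <= N.
Proof.
move=> cN; suff : (\sum_(t < M) c t) * 2 ^ M <= N * (2 ^ M).-1.
  by move=> le; rewrite -(@leq_pmul2r (2 ^ M)) ?expn_gt0 // (leq_trans le) // leq_mul2l leq_pred orbT.
elim: M cN => [|M IH] cN; first by rewrite big_ord0.
rewrite big_ord_recr /= mulnDl.
have {}IH := IH (fun t tM => cN t (ltnW tM)).
have := cN M (leqnn _); move: IH; rewrite expnS.
have : 0 < 2 ^ M by rewrite expn_gt0.
move: (\sum_(t < M) c t) (c M) (2 ^ M) => a b e; nia.
Qed.

(** A nonempty set has at least d + 1 vertices in its neighbourhood, so only
    the sizes t >= d enter the union bound; their total probability 8^(-t),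
    summed over t >= d, is at most 2^(-d). *)
Lemma card_not_expands m d : 16 * d.+1 <= m -> 0 < d ->
  #|[set G in regular_graphs m d | ~~ expands d G]| * 2 ^ d <= #|regular_graphs m d|.
Proof.
move=> dm d0; set bad := [set G in _ | _].
pose B t := [set G in regular_graphs m d |
      [exists (q : {set 'I_m} * {set 'I_m} | confined_pair d t q), nbhd G q.2 \subset q.1]].
have sub : bad \subset \bigcup_(t < m.+1 | (d <= t) && (64 * t <= m)) B t.
  apply/subsetP => G /setIdP[GR]; rewrite negb_forall => /existsP[S].
  rewrite negb_imply -leqNgt => /andP[/andP[S0 Tm] dS].
  have Tm' : #|nbhd G S| < m.+1 by lia.
  apply/bigcupP; exists (Ordinal Tm') => /=.
    rewrite Tm andbT; have [s sS] := set0Pn _ S0.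
    apply: (@leq_trans #|closed_nbhd G s|); first by rewrite (card_closed_nbhd s GR).
    apply/subset_leq_card/subsetP => w ws; by apply/bigcupP; exists s.
  apply/setIdP; split=> //; apply/existsP; exists (nbhd G S, S).
  by rewrite /confined_pair /= eqxx sub_nbhd card_gt0 S0 dS subxx.
apply: (@leq_trans (\sum_(t < m.+1) if (d <= t) && (64 * t <= m) then #|B t| * 2 ^ d else 0)).
  rewrite -big_mkcond /= -big_distrl /= leq_mul2r; apply/orP; right.
  exact: leq_trans (subset_leq_card sub) (leq_card_bigcup _ _).
apply: (geometric_sum_le (c := fun t => if (d <= t) && (64 * t <= m) then #|B t| * 2 ^ d else 0)) => t _.
case: ifP => // /andP[dt tm]; apply: leq_trans (card_confined dm d0 _ tm); last by lia.
rewrite -mulnA leq_mul2l -expnD (_ : 8 = 2 ^ 3) // -expnM leq_exp2l //.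
by apply/orP; right; lia.
Qed.

(** By Bernoulli's inequality, (1 - b)^n (1 + n b) is at most 1. *)
Lemma exists_expr_le_eighth (b : rat) :
  (0 < b < 1)%R -> exists L, ((1 - b) ^+ L <= 8^-1)%R.
Proof.
move=> /andP[b0 b1].
have bern n : ((1 - b) ^+ n * (1 + n%:R * b) <= 1)%R.
  elim: n => [|n IH]; first by rewrite expr0 mul0r addr0 mulr1.
  apply: le_trans IH; rewrite exprSr -mulrA ler_wpM2l ?exprn_ge0 //; first lra.
  rewrite -natr1; have : (0 <= n%:R :> rat)%R by []; nra.
have [n] : exists n, (7 / b < n%:R)%R.
  by exists (Num.bound (7 / b)); apply: archi_boundP; rewrite divr_ge0 // ltW.
rewrite ltr_pdivrMr // => nb; exists n.
have p0 : (0 <= (1 - b) ^+ n)%R by rewrite exprn_ge0 //; lra.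
rewrite -[(8^-1)%R]mul1r ler_pdivlMr //; apply: le_trans (bern n).
by rewrite ler_wpM2l //; lra.
Qed.

Lemma card_pairs_between_disjoint n (A B : {set 'I_n}) :
  [disjoint A & B] -> #|pairs_between A B| = #|A| * #|B|.
Proof.
move=> AB; rewrite /pairs_between curry_imset2X card_in_imset ?cardsX //.
move=> [a b] [a' b']; rewrite !in_setX /= => /andP[aA bB] /andP[a'A b'B] E.
have : a \in [set a'; b'] by rewrite -E set21.
rewrite !inE => /orP[/eqP aa|/eqP ab]; last by rewrite -ab (disjointFr AB aA) in b'B.
by move: E; rewrite aa => /set2_inj ->.
Qed.

(** When no edge joins A to B, all the m d / 2 edges fit into the set E of the
    pairs outside A x B, which misses a fixed proportion 2b of all pairs. Since
    k is at most b m d / 6, the two corrections by k in the tail bound and the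
    one by 2d(d+1) are too small to make up for this loss, and each of the k
    factors is at most 1 - b. *)
Lemma card_separated_pair (b : rat) m d k (A B : {set 'I_m}) :
  (b * (64 * 64) = 1)%R -> ~~ odd (m * d) ->
  m < 64 * #|A| -> m < 64 * #|B| -> 0 < d ->
  6 * (64 * 64) * k <= m * d -> 6 * (64 * 64) * d.+1 <= m ->
  (#|[set G in regular_graphs m d | nbhd G A :&: B == set0]|%:R
     <= #|regular_graphs m d|%:R * (1 - b) ^+ k :> rat)%R.
Proof.
move=> bE md_even Am Bm d0 km dm; set bad := [set G in _ | _]; set N := #|regular_graphs m d|.
have [-> |[G0 /setIdP[_ /eqP G0AB]]] := set_0Vmem bad.
  rewrite cards0 mulr_ge0 ?exprn_ge0 //; lra.
have disjAB : [disjoint A & B].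
  rewrite -setI_eq0 -subset0 -G0AB setSI //; exact: sub_nbhd.
pose E := [set e : {set 'I_m} | #|e| == 2] :\: pairs_between A B.
pose x := (m * d)./2; pose D := m * d - 2 * k - 2 * (d * d.+1).
have x2 : m * d = 2 * x by rewrite /x; lia.
have badP : bad \subset [set G in regular_graphs m d | x <= #|G :&: E|].
  apply/subsetP => G /setIdP[GR /eqP GAB]; apply/setIdP; split=> //.
  have /setIidPl -> : G \subset E.
    apply/subsetP => e eG; rewrite !inE; apply/andP; split; last first.
      by move: e eG; apply/forall_inP/(regular_simple GR).
    apply/imset2P => -[a c aA cB eac].
    have : c \in nbhd G A :&: B.
      rewrite inE cB andbT; apply/bigcupP; exists a => //.
      by rewrite !inE /adj -eac eG orbT.
    by rewrite GAB inE.
  by have := regular_card GR; rewrite x2; lia.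
have tail : #|bad| * ((x - k) * D) ^ k <= N * (#|E| * (d * d)) ^ k.
  apply: leq_trans (@regular_edge_tail m d E x k).
  by rewrite leq_mul2r subset_leq_card ?orbT.
have Ecard : #|E| + #|A| * #|B| <= 'C(m, 2).
  rewrite -card_pairs_between_disjoint // -[m in 'C(m, 2)]card_ord -card_draws.
  rewrite -[X in _ <= X](cardsID (pairs_between A B)) addnC leq_add2r.
  apply/subset_leq_card/subsetP => _ /imset2P[a c aA cB ->].
  rewrite inE [_ \in pairs_between A B]imset2_f // andbT inE cards2.
  suff -> : a != c by [].
  by apply: contraTneq aA => ->; rewrite (disjointFl disjAB cB).
have {}Ecard : 2 * (64 * 64 * #|E|) + 2 * (m * m) <= 64 * 64 * (m * m).
  have : 2 * 'C(m, 2) <= m * m by rewrite bin2; lia.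
  have : m * m <= 64 * #|A| * (64 * #|B|) by rewrite leq_mul // ltnW.
  by lia.
pose M : rat := (m%:R)%R; pose W : rat := (m * d)%:R%R.
have W0 : (0 < W)%R by rewrite ltr0n muln_gt0 d0; lia.
have b0 : (0 < b)%R by lra.
have scale (j : nat) : 6 * (64 * 64) * j <= m * d -> (j%:R <= W * (b / 6))%R.
  rewrite -(ler_nat rat) -/W natrM !natrM => le.
  have := ler_wpM2r (ltW b0) le.
  have : (j%:R * (64 * 64 * b) = j%:R)%R by rewrite [(_ * b)%R]mulrC bE mulr1.
  lra.
have kW := scale _ km.
have dW : ((d * d.+1)%:R <= W * (b / 6))%R by apply: scale; nia.
have xk : (W * (1 / 2 - b / 6) <= (x - k)%:R)%R.
  have : x <= (x - k) + k by lia.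
  rewrite -(ler_nat rat) natrD => le.
  have : W = (2 * x%:R)%R by rewrite /W x2 natrM.
  lra.
have DW : (W * (1 - 4 * (b / 6)) <= D%:R)%R.
  have : m * d <= D + 2 * k + 2 * (d * d.+1) by rewrite /D; lia.
  rewrite -(ler_nat rat) !natrD -/W => le; lra.
have EW : (#|E|%:R * (d * d)%:R <= W ^+ 2 * (1 / 2 - b))%R.
  move: Ecard; rewrite -(ler_nat rat) natrD !natrM -/M => Ecard.
  rewrite /W natrM -/M.
  have le : (#|E|%:R <= M ^+ 2 * (1 / 2 - b))%R.
    have := ler_wpM2r (ltW b0) Ecard.
    have : (#|E|%:R * (64 * 64 * b) = #|E|%:R)%R by rewrite [(_ * b)%R]mulrC bE mulr1.
    have : (M * M * (64 * 64 * b) = M * M)%R by rewrite [(_ * b)%R]mulrC bE mulr1.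
    lra.
  have := ler_wpM2r (sqr_ge0 (d%:R : rat)) le.
  by rewrite -expr2 exprMn mulrAC.
have Y0 : (0 < (x - k)%:R * D%:R :> rat)%R.
  rewrite mulr_gt0 // ?(lt_le_trans _ xk) ?(lt_le_trans _ DW) // mulr_gt0 //; lra.
have Ylow : (W ^+ 2 * ((1 / 2 - b / 6) * (1 - 4 * (b / 6))) <= (x - k)%:R * D%:R)%R.
  apply: le_trans (ler_pM _ _ xk DW); try (rewrite mulr_ge0 ?(ltW W0) //; lra).
  by rewrite le_eqVlt; apply/orP; left; apply/eqP; ring.
have EY : (#|E|%:R * (d * d)%:R <= (1 - b) * ((x - k)%:R * D%:R))%R.
  apply: le_trans EW _.
  have b1 : (0 <= 1 - b)%R by lra.
  apply: le_trans (ler_wpM2l b1 Ylow).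
  rewrite mulrCA ler_wpM2l ?sqr_ge0 //; nra.
rewrite -(ler_pM2r (exprn_gt0 k Y0)).
move: tail; rewrite -(ler_nat rat) !natrM !natrX !natrM => /le_trans; apply.
rewrite -mulrA ler_wpM2l // -exprMn lerXn2r // ?nnegrE.
- by rewrite !mulr_ge0.
- by rewrite mulr_ge0 ?(ltW Y0) //; lra.
- by rewrite -natrM.
Qed.

(** With b = 1/4096, take k = L m where (1 - b)^L <= 1/8: then 8^(-m) beats the
    4^m pairs of sets, and k is a small enough part of m d once d is a large
    multiple of L. *)
Lemma card_not_joins_large : exists D0, forall m d,
  D0 <= d -> D0 * d <= m -> ~~ odd (m * d) ->
  #|[set G in regular_graphs m d | ~~ joins_large G]| * 2 ^ m <= #|regular_graphs m d|.
Proof.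
have [b bE] : exists b : rat, (b * (64 * 64) = 1)%R.
  by exists ((64 * 64)^-1)%R; rewrite mulVf // mulf_neq0 // pnatr_eq0.
have [|L Lb] := @exists_expr_le_eighth b; first by apply/andP; lra.
exists (12 * (64 * 64) * L.+1) => m d dL dm md_even.
have d0 : 0 < d by lia.
have kd : 6 * (64 * 64) * (L * m) <= m * d.
  by rewrite mulnA mulnC leq_mul2l; apply/orP; right; lia.
have dm' : 6 * (64 * 64) * d.+1 <= m.
  by have := leq_pmull d (ltn0Sn L); lia.
set bad := [set G in _ | _]; set N := #|regular_graphs m d|.
pose J (q : {set 'I_m} * {set 'I_m}) := (m < 64 * #|q.1|) && (m < 64 * #|q.2|).
have sub : bad \subset [set G in regular_graphs m d |
    [exists (q | J q), nbhd G q.1 :&: q.2 == set0]].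
  apply/subsetP => G /setIdP[GR /forallPn[A /forallPn[B]]].
  rewrite negb_imply negbK => /andP[AB GAB]; apply/setIdP; split=> //.
  by apply/existsP; exists (A, B); rewrite /J AB.
have union : (#|bad|%:R <= (4 ^ m)%:R * (N%:R * (1 - b) ^+ (L * m)) :> rat)%R.
  apply: (@le_trans _ _ (\sum_(q | J q) N%:R * (1 - b) ^+ (L * m))%R); last first.
    have -> : 4 ^ m = #|{: {set 'I_m} * {set 'I_m}}|.
      rewrite card_prod -cardsT -powersetT card_powerset cardsT card_ord.
      by rewrite -expnMn.
    rewrite sumr_const [leRHS]mulr_natl ler_wpMn2l ?max_card //.
    by rewrite mulr_ge0 // exprn_ge0 //; lra.
  have := leq_trans (subset_leq_card sub) (card_union_bound _ _ _).
  rewrite -(ler_nat rat) natr_sum => /le_trans; apply.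
  apply: ler_sum => q /andP[Am Bm].
  exact: card_separated_pair.
rewrite -(ler_nat rat) natrM.
have p : (0 < (2 ^ m)%:R :> rat)%R by rewrite ltr0n expn_gt0.
rewrite -ler_pdivlMr //; apply: le_trans union _.
rewrite mulrCA ler_wpM2l // -[leRHS]mul1r ler_pdivlMr //.
rewrite exprM !natrX mulrAC -!exprMn.
have : ((4 * 2 * (1 - b) ^+ L) ^+ m <= 1 :> rat)%R.
  apply: exprn_ile1; last lra.
  by rewrite mulr_ge0 // exprn_ge0 //; lra.
by [].
Qed.

Lemma card_not_expander : exists D0, forall m d,
  D0 <= d -> D0 * d <= m -> ~~ odd (m * d) ->
  #|[set H in regular_graphs m d | ~~ (expands d H && joins_large H)]| * 2 ^ d
    <= 2 * #|regular_graphs m d|.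
Proof.
have [D0 joins] := card_not_joins_large; exists (D0 + 32) => m d dD dm md_even.
have d0 : 0 < d by lia.
have := joins m d ltac:(lia) ltac:(lia) md_even.
have := @card_not_expands m d ltac:(lia) d0.
set e := [set H in _ | _]; set l := [set H in _ | _]; set N := #|regular_graphs m d| => eN lN.
have {}lN : #|l| * 2 ^ d <= N.
  by apply: leq_trans lN; rewrite leq_mul2l leq_exp2l //; apply/orP; right; lia.
apply: (@leq_trans ((#|e| + #|l|) * 2 ^ d)); last by rewrite mulnDl mul2n -addnn leq_add.
rewrite leq_mul2r; apply/orP; right.
apply: leq_trans (leq_card_setU _ _); apply/subset_leq_card/subsetP => H.
case/setIdP => HR; rewrite negb_and => bad.
by apply/setUP; case/orP: bad => bad; [left|right]; apply/setIdP.
Qed.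

(** * Random regular graphs are stretched by every map *)

(** The pairs of vertices that f sends to within distance r in H. *)
Definition close_pairs n m (H : edges_on m) (r : nat) (f : {ffun 'I_n -> 'I_m}) : edges_on n :=
  [set [set p.1; p.2] | p : 'I_n * 'I_n in [set p | f p.2 \in gball H r (f p.1)]].

Definition fibers_le n m (F : nat) (f : {ffun 'I_n -> 'I_m}) : bool :=
  [forall i, #|[set v | f v == i]| <= F].

Lemma card_close_pairs n m d (H : edges_on m) r F (f : {ffun 'I_n -> 'I_m}) :
  H \in regular_graphs m d -> fibers_le F f ->
  #|close_pairs H r f| <= n * (d.+1 ^ r * F).
Proof.
move=> HR /forallP fF; apply: leq_trans (leq_imset_card _ _) _.
rewrite -sum1dep_card -(pair_big_dep xpredT (fun u v => f v \in gball H r (f u)) (fun _ _ => 1)) /=.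
rewrite -[n in n * _]card_ord -sum_nat_const; apply: leq_sum => u _.
rewrite (partition_big f (mem (gball H r (f u)))) //=.
apply: (@leq_trans (\sum_(i in gball H r (f u)) F)); last first.
  by rewrite sum_nat_const leq_mul2r card_gball ?orbT.
apply: leq_sum => i _; apply: leq_trans (fF i).
rewrite sum1dep_card; apply/subset_leq_card/subsetP => v.
by rewrite !inE => /andP[].
Qed.

(** The tail bound for x = n d / 4, a half of the edges. There are at most
    n (d+1)^r F close pairs, so each of the k factors is of the order of
    (d+1)^r F / n. *)
Lemma card_many_close n m d (H : edges_on m) r F k (f : {ffun 'I_n -> 'I_m}) :
  H \in regular_graphs m d -> fibers_le F f -> 0 < d -> 16 * d.+1 <= n ->
  16 * k <= n * d ->
  #|[set G in regular_graphs n d | (n * d) %/ 4 <= #|G :&: close_pairs H r f| ]| * n ^ k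
     <= #|regular_graphs n d| * (32 * (d.+1 ^ r * F)) ^ k.
Proof.
move=> HR fF d0 dn kn; set bad := [set G in _ | _]; set N := #|regular_graphs n d|.
have := regular_edge_tail d (close_pairs H r f) ((n * d) %/ 4) k.
rewrite -/N -/bad; set x := _ %/ 4; set D := n * d - _ - _ => tail.
have dnd : 16 * d.+1 * d <= n * d by rewrite leq_mul2r dn orbT.
have xk : n * d <= 16 * (x - k) by rewrite /x; lia.
have D2 : n * d <= 2 * D by rewrite /D; lia.
have Ec := card_close_pairs r HR fF.
have pos : 0 < (n * d * d) ^ k by rewrite expn_gt0 !muln_gt0 d0; lia.
rewrite -(leq_pmul2r pos).
apply: (@leq_trans (#|bad| * ((x - k) * D) ^ k * 32 ^ k)).
  rewrite -!mulnA -!expnMn leq_mul2l leq_expn2r ?orbT //.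
  have := leq_mul xk D2; lia.
apply: leq_trans (leq_mul tail (leqnn _)) _.
rewrite -!mulnA -!expnMn leq_mul2l; apply/orP; right.
apply: leq_expn2r.
have := leq_mul Ec (leqnn (d * d * 32)); lia.
Qed.

(** The j-th power of 32 (d+1)^r F / n is at most 1/m by hypothesis, so k = 2 n j
    makes the probability for a single f at most m^(-2n), and the m^n
    functions f cost only m^n. *)
Lemma card_not_spread n m d (H : edges_on m) j r F :
  H \in regular_graphs m d -> 1 < m -> 0 < d -> 32 * j <= d -> 16 * d.+1 <= n ->
  (32 * (d.+1 ^ r * F)) ^ j * m <= n ^ j ->
  #|[set G in regular_graphs n d |
      [exists (f : {ffun 'I_n -> 'I_m} | fibers_le F f),
        (n * d) %/ 4 <= #|G :&: close_pairs H r f| ] ]| * 2 ^ d <= #|regular_graphs n d|.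
Proof.
move=> HR m1 d0 jd dn hF; set bad := [set G in _ | _]; set N := #|regular_graphs n d|.
have n0 : 0 < n by lia.
have kn : 16 * (j * (2 * n)) <= n * d.
  by have := leq_mul (leqnn n) jd; lia.
apply: (@leq_trans (#|bad| * m ^ n)).
  rewrite leq_mul2l; apply/orP; right.
  by apply: (@leq_trans (2 ^ n)); [rewrite leq_exp2l //; lia | exact: leq_expn2r].
have pos : 0 < n ^ (j * (2 * n)) * m ^ n by rewrite muln_gt0 !expn_gt0 n0; lia.
rewrite -(leq_pmul2r pos).
apply: (@leq_trans (m ^ n * (N * (32 * (d.+1 ^ r * F)) ^ (j * (2 * n))) * m ^ (2 * n))).
  rewrite (_ : _ * _ * (_ * _) = #|bad| * n ^ (j * (2 * n)) * m ^ (2 * n)); last first.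
    rewrite mul2n -addnn expnD; move: (_ ^ (j * _)) (m ^ n) => a b; ring.
  rewrite leq_mul2r; apply/orP; right.
  apply: leq_trans (leq_mul (card_union_bound _ _ _) (leqnn _)) _.
  rewrite big_distrl /=.
  apply: (@leq_trans (\sum_(f : {ffun 'I_n -> 'I_m} | fibers_le F f) N * (32 * (d.+1 ^ r * F)) ^ (j * (2 * n)))).
    by apply: leq_sum => f fF; apply: card_many_close.
  rewrite sum_nat_cond_const leq_mul2r; apply/orP; right.
  by apply: leq_trans (max_card _) _; rewrite card_ffun !card_ord.
rewrite -!mulnA mulnCA leq_mul2l; apply/orP; right.
rewrite [X in _ <= X]mulnC leq_mul2l; apply/orP; right.
by rewrite !(expnM _ j) -expnMn leq_expn2r.
Qed.

Lemma sum_oriented_edges n (K : edges_on n) : simple K ->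
  \sum_(u < n) \sum_(v < n | (u < v) && adj K u v) 1 = #|K|.
Proof.
move=> sK; apply/eqP; rewrite -(@eqn_pmul2l 2) // -handshake // mul2n -addnn.
rewrite [X in X + _]pair_big_dep /= [X in _ + X]pair_big_dep /=.
have -> : \sum_v degree K v = \sum_(p : 'I_n * 'I_n | adj K p.1 p.2) 1.
  by rewrite -(pair_big_dep xpredT (adj K) (fun _ _ => 1)) /=; apply: eq_bigr => u _; rewrite sum1dep_card.
rewrite [X in _ == X](bigID (fun p : 'I_n * 'I_n => p.1 < p.2)) /=; apply/eqP; congr addn.
  by apply: eq_bigl => p; rewrite andbC.
rewrite (reindex_inj (h := fun p : 'I_n * 'I_n => (p.2, p.1))) /=; last by case=> a b [c e] [-> ->].
apply: eq_bigl => -[u v] /=; rewrite (adjC K v u) andbC; case uv: (adj K u v) => //=.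
have nuv : u != v :> nat.
  by apply: contraTneq uv => /val_inj ->; rewrite adj_irrefl.
lia.
Qed.

(** At least half of the n d / 2 edges of G are stretched to length r + 1 or
    more, so the sum over the edges is at least (r+1)^2 n d / 4, while the mean
    over all pairs of vertices is at most L^2. *)
Lemma gamma_le_spread (R : realType) n m d (G : edges_on n) (H : edges_on m)
    (f : {ffun 'I_n -> 'I_m}) r L (C : R) :
  G \in regular_graphs n d -> 0 < n -> 0 < d -> r < m ->
  (forall x y, gdist H x y <= L) ->
  #|G :&: close_pairs H r f| < (n * d) %/ 4 ->
  (4 * L%:R ^+ 2 <= C * r.+1%:R ^+ 2)%R ->
  gamma_le d G H f C.
Proof.
move=> GR n0 d0 rm HL few LC.
pose K := G :\: close_pairs H r f.
have sK : simple K by apply: (simple_sub (subsetDl _ _)); exact: regular_simple GR.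
have K4 : n * d <= 4 * #|K|.
  have := cardsID (close_pairs H r f) G; rewrite -/K; have := regular_card GR; lia.
have nR : (0 < n%:R :> R)%R by rewrite ltr0n.
have dR : (0 < d%:R :> R)%R by rewrite ltr0n.
have rR : (0 < r.+1%:R ^+ 2 :> R)%R by rewrite exprn_gt0 ?ltr0n.
have C0 : (0 <= C)%R.
  rewrite -(pmulr_lge0 _ rR); apply: le_trans LC.
  by rewrite mulr_ge0 // exprn_ge0.
apply: (@le_trans _ _ (L%:R ^+ 2)%R).
  rewrite ler_pdivrMl ?exprn_gt0 // mulrC.
  rewrite [leRHS](_ : _ = \sum_(u < n) \sum_(v < n) L%:R ^+ 2)%R; last first.
    by rewrite !sumr_const !card_ord -mulrnA -[(n%:R ^+ 2)%R]natrX mulr_natr mulnn.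
  apply: ler_sum => u _; apply: ler_sum => v _.
  by rewrite lerXn2r ?nnegrE // ler_nat.
apply: (@le_trans _ _ (C / (d%:R * n%:R) * (#|K|%:R * r.+1%:R ^+ 2))%R); last first.
  rewrite ler_wpM2l ?divr_ge0 ?mulr_ge0 //.
  rewrite -(sum_oriented_edges sK) natr_sum mulr_suml; apply: ler_sum => u _.
  rewrite natr_sum mulr_suml [leLHS]big_mkcond [leRHS]big_mkcond; apply: ler_sum => v _.
  case: (u < v) => //=; case uvK: (adj K u v); last by case: ifP => // _; rewrite exprn_ge0.
  move: uvK; rewrite /adj inE => /andP[uvE ->]; rewrite mul1r lerXn2r ?nnegrE // ler_nat.
  rewrite ltnNge; apply: contra uvE => le; apply/imsetP; exists (u, v) => //.
  by rewrite inE /=; apply: gball_gdist.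
have : (n%:R * d%:R <= 4 * #|K|%:R :> R)%R by rewrite -!natrM ler_nat.
move=> K4R; rewrite mulrAC ler_pdivlMr ?mulr_gt0 //.
have nd0 : (0 <= d%:R * n%:R :> R)%R by rewrite mulr_ge0.
have := ler_wpM2r nd0 LC.
have := ler_wpM2r (mulr_ge0 C0 (ltW rR)) K4R.
lra.
Qed.

(** * The probability of the inequality *)

Lemma card_setX_sections (T1 T2 : finType) (A : {set T1}) (B : {set T2}) (P : pred (T1 * T2)) :
  #|[set x in setX A B | P x]| = \sum_(y in B) #|[set x in A | P (x, y)]|.
Proof.
under [RHS]eq_bigr do rewrite -sum1dep_card.
rewrite (exchange_big_dep (mem A)) /=; last by move=> y x _ /andP[].
rewrite pair_big_dep /= sum1dep_card; apply: eq_card => -[x y].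
by rewrite !inE /=; case: (x \in A); case: (y \in B).
Qed.

Lemma prob_gamma_le1 (R : realType) n m d (delta C : R) :
  (prob_gamma_le n m d delta C <= 1)%R.
Proof.
rewrite /prob_gamma_le /unif_prob; set a := #|_|; set b := #|_|.
have ab : a <= b by apply/subset_leq_card/subsetP => x /setIdP[].
have [->|b0] := posnP b; first by rewrite invr0 mulr0.
by rewrite ler_pdivrMr ?ltr0n // mul1r ler_nat.
Qed.

(** The scales: l = floor (log_d m) and r = floor (l / j). The diameter of H is
    at most 4l + 5, which is at most 9 j (r+1), and 324 = 4 * 9^2. The balls of
    radius r satisfy ((d+1)^r)^j <= (d+1)^l <= m^2; as delta^j >= m^4, the
    fibers, of size at most F = floor (n / delta), satisfy
    (32 (d+1)^r F / n)^j <= 32^j m^2 / m^4 <= 1/m. *)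
Lemma prob_gamma_ge (R : realType) (j : nat) : 0 < j ->
  exists D0, forall n m d (delta : R),
  D0 <= d -> d ^ 2 <= m -> m <= n -> ~~ odd (n * d) -> ~~ odd (m * d) ->
  (0 < delta)%R -> (m%:R ^+ 4 <= delta ^+ j)%R ->
  (1 - 3 / 2 ^+ d <= prob_gamma_le n m d delta (324 * j%:R ^+ 2))%R.
Proof.
move=> j0; have [D1 expander] := card_not_expander.
exists (D1 + 256 + 32 * j + 32 ^ j) => n m d delta dD dm mn nd_even md_even delta0 mdelta.
have d0 : 0 < d by lia.
have d256 : 256 <= d by lia.
have dm' D : D <= d -> D * d <= m.
  by move=> Dd; apply: leq_trans dm; rewrite -mulnn leq_mul2r Dd orbT.
have D1d : D1 <= d by lia.
have dm1 := dm' _ D1d.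
have m256 : 256 * d <= m by apply: dm'; lia.
have m32 : 32 ^ j <= m by have := dm' _ (leqnn d); nia.
have [n0 m1] : 0 < n /\ 1 < m by lia.
have [jd dn] : 32 * j <= d /\ 16 * d.+1 <= n by lia.
set C := (324 * _)%R.
pose l := trunc_log d m.
have /andP[lm ml] : d ^ l <= m < d ^ l.+1 by apply: trunc_log_bounds; lia.
pose r := l %/ j.
have rl : r * j <= l by exact: leq_divM.
have lr : l.+1 <= j * r.+1 by rewrite mulnC ltn_ceil.
have rm : r < m.
  apply: leq_ltn_trans (leq_div _ _) (leq_trans _ lm).
  by apply: ltn_expl; lia.
pose F := Num.truncn (n%:R / delta).
have /andP[Fn nF] : (F%:R <= n%:R / delta < F.+1%:R)%R.
  by apply: truncn_itv; rewrite divr_ge0 ?(ltW delta0).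
have small : {subset small_fibers n m delta <= fibers_le F}.
  move=> f; rewrite inE => /forallP fs; apply/forallP => i.
  by rewrite -ltnS -(ltr_nat R) (le_lt_trans _ nF).
have hF : (32 * (d.+1 ^ r * F)) ^ j * m <= n ^ j.
  have bj : (d.+1 ^ r) ^ j <= m ^ 2.
    rewrite -expnM; apply: (@leq_trans (d.+1 ^ l)).
      by rewrite leq_exp2l //; lia.
    apply: (@leq_trans ((d ^ l) ^ 2)); last exact: leq_expn2r.
    rewrite -expnM mulnC expnM leq_expn2r //; nia.
  have Fj : (F%:R ^+ j * m%:R ^+ 4 <= n%:R ^+ j :> R)%R.
    apply: le_trans (ler_wpM2l _ mdelta) _; first by rewrite exprn_ge0.
    rewrite -exprMn lerXn2r ?nnegrE ?mulr_ge0 ?(ltW delta0) //.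
    by rewrite -ler_pdivlMr.
  have {}Fj : F ^ j * m ^ 4 <= n ^ j by rewrite -(ler_nat R) natrM !natrX.
  apply: leq_trans Fj; rewrite !expnMn.
  have := leq_mul (leq_mul m32 bj) (leqnn (F ^ j * m)).
  by rewrite !expnS !expn0 !muln1; lia.
have good G H : G \in regular_graphs n d -> H \in regular_graphs m d ->
    expands d H && joins_large H ->
    ~~ (connected_graph H && [forall f in small_fibers n m delta, gamma_le d G H f C]) ->
    [exists (f : {ffun 'I_n -> 'I_m} | fibers_le F f),
        (n * d) %/ 4 <= #|G :&: close_pairs H r f| ].
  move=> GR HR /andP[Hexp Hj].
  have diam x y := @diameter_le m d H l x y d256 ml Hexp Hj.
  rewrite (connected_gball diam) /= negb_forall_in => /exists_inP[f /small fF].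
  apply: contraNT; rewrite negb_exists_in => /forall_inP/(_ _ fF); rewrite -ltnNge => few.
  apply: (gamma_le_spread GR n0 d0 rm _ few) => [x y|]; first exact/gdist_le/diam.
  rewrite /C; have : (4 * l.+1).+1 <= 9 * (j * r.+1) by clear - lr; lia.
  rewrite -(ler_nat R) !natrM => le.
  have : ((4 * l.+1).+1%:R ^+ 2 <= (9 * (j%:R * r.+1%:R)) ^+ 2 :> R)%R.
    by rewrite lerXn2r ?nnegrE ?mulr_ge0.
  clear; lra.
rewrite /prob_gamma_le /unif_prob cardsX.
pose A (GH : edges_on n * edges_on m) := connected_graph GH.2 &&
  [forall f in small_fibers n m delta, gamma_le d GH.1 GH.2 f C].
pose Om := setX (regular_graphs n d) (regular_graphs m d).
pose Nn := #|regular_graphs n d|; pose Nm := #|regular_graphs m d|.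
rewrite -/A -/Om -/Nn -/Nm.
have Nn0 : 0 < Nn by apply: regular_graphs_neq0 => //; lia.
have Nm0 : 0 < Nm by apply: regular_graphs_neq0 => //; lia.
(* Either H is not an expander, or G does not stretch some map into H. *)
pose bad := [set GH in Om | ~~ A GH].
have bad_le : #|bad| * 2 ^ d <= 3 * (Nn * Nm).
  rewrite /bad card_setX_sections big_distrl /=.
  pose badH := [set H in regular_graphs m d | ~~ (expands d H && joins_large H)].
  apply: (@leq_trans (\sum_(H in regular_graphs m d) (Nn + (H \in badH) * (Nn * 2 ^ d)))).
    apply: leq_sum => H HR; have [HB|HB] := boolP (H \in badH).
      rewrite mul1n; apply: leq_trans (leq_addl _ _); rewrite leq_mul2r; apply/orP; right.
      by apply/subset_leq_card/subsetP => G /setIdP[].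
    rewrite mul0n addn0.
    apply: leq_trans (@card_not_spread n m d H j r F HR m1 d0 jd dn hF).
    rewrite leq_mul2r; apply/orP; right; apply/subset_leq_card/subsetP => G /setIdP[GR nA].
    apply/setIdP; split=> //; apply: good nA => //.
    by apply: contraNT HB => HB; apply/setIdP.
  rewrite big_split /= sum_nat_const -big_distrl /=.
  have -> : \sum_(H in regular_graphs m d) (H \in badH) = #|badH|.
    rewrite -big_mkcondr /= sum1_card; apply: eq_card => H.
    rewrite [in RHS]inE; apply/andP/andP => [[HR]|[HR ?]]; first by rewrite inE => /andP[].
    by split=> //; apply/setIdP.
  have := expander m d D1d dm1 md_even; rewrite -/badH -/Nm => /(leq_mul (leqnn Nn)).
  by rewrite -/Nm; lia.
have tot : #|[set x in Om | A x]| + #|bad| = Nn * Nm.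
  rewrite -cardsX -/Om -(cardsID [set x | A x] Om); congr addn; apply: eq_card => x.
    by rewrite !inE.
  by rewrite !inE andbC.
rewrite -tot; set g := #|[set x in Om | A x]| in tot *.
have NN : 0 < Nn * Nm by rewrite muln_gt0 Nn0.
rewrite ler_pdivlMr ?ltr0n ?tot //.
have p : (0 < 2 ^+ d :> R)%R by rewrite exprn_gt0.
have : (#|bad|%:R <= 3 / 2 ^+ d * (Nn * Nm)%:R :> R)%R.
  by rewrite mulrAC ler_pdivlMr // -natrX -!natrM ler_nat.
have : ((Nn * Nm)%:R = g%:R + #|bad|%:R :> R)%R by rewrite -natrD tot.
lra.
Qed.

(** * Passage to the limit *)

From mathcomp Require Import all_classical all_reals all_analysis.
Import numFieldNormedType.Exports.

Local Open Scope classical_set_scope.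
Local Open Scope ring_scope.

(** As d is at most the square root of m, the factor m^(1/2) / d in the lower
    bound for delta is at least 1, and so delta is at least m^eps. *)
Lemma expr4_le_exprn (R : realType) (m d j : nat) (eps delta : R) :
  (0 < d)%N -> (0 < m)%N -> (d%:R : R) <= Num.sqrt m%:R -> 0 < eps -> 4 <= eps * j%:R ->
  2 * Num.sqrt (2 * expR 1) / d%:R * m%:R `^ (1 / 2 + 4 / (d%:R + 1) + eps) <= delta ->
  m%:R ^+ 4 <= delta ^+ j.
Proof.
move=> d0 m0 dm eps0 epsj.
have m1 : 1 <= m%:R :> R by rewrite ler1n.
have dR : 0 < d%:R :> R by rewrite ltr0n.
set A := (X in X <= _) => Adelta.
have mA : m%:R `^ eps <= A.
  have e1 : 1 <= Num.sqrt (2 * expR 1) :> R.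
    rewrite -[leLHS]sqrtr1 ler_sqrt ?mulr_ge0 ?expR_ge0 //.
    by have := expR_ge1Dx (1 : R); lra.
  have pw : Num.sqrt m%:R * m%:R `^ eps <= m%:R `^ (1 / 2 + 4 / (d%:R + 1) + eps).
    rewrite div1r -powR12_sqrt // -powRD; last by apply/implyP => _; rewrite gt_eqF // ltr0n.
    by rewrite ler_powR // lerD2r lerDl divr_ge0.
  apply: le_trans (ler_wpM2l _ pw); last first.
    by rewrite divr_ge0 ?mulr_ge0 ?sqrtr_ge0.
  rewrite mulrA ler_peMl ?powR_ge0 // mulrAC ler_pdivlMr // mul1r.
  apply: le_trans dm _; rewrite ler_peMl ?sqrtr_ge0 //; lra.
have {mA}mdelta := le_trans mA Adelta.
apply: (@le_trans _ _ ((m%:R `^ eps) ^+ j)); last first.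
  by rewrite lerXn2r ?nnegrE ?powR_ge0 // (le_trans _ mdelta) ?powR_ge0.
rewrite -powR_mulrn ?powR_ge0 // -powRrM -powR_mulrn // ler_powR //.
Qed.

Theorem theorem3 (R : realType) (m d : nat -> nat) (eps : R) (delta : nat -> R)
  (m_oo : m n @[n --> admissible_oo m d] --> \oo)
  (d_oo : d n @[n --> admissible_oo m d] --> \oo)
  (m_le_n : \forall n \near admissible_oo m d, (m n <= n)%N)
  (d_small : (fun n => (d n)%:R : R^o)
     =o_ (admissible_oo m d) (fun n => Num.sqrt (m n)%:R : R^o))
  (eps_gt0 : 0 < eps)
  (delta_gt0 : forall k, 0 < delta k)
  (delta_large :
     (fun n => 2 * Num.sqrt (2 * expR 1) / (d n)%:R
                 * (m n)%:R `^ (1 / 2 + 4 / ((d n)%:R + 1) + eps) : R^o)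
     =o_ (admissible_oo m d) (fun n => delta (m n) : R^o)) :
  exists C : R,
    prob_gamma_le n (m n) (d n) (delta (m n)) C @[n --> admissible_oo m d] --> (1 : R).
Proof.
have [j [j0 epsj]] : exists j : nat, (0 < j)%N /\ 4 <= eps * j%:R.
  exists (Num.bound (4 / eps)).+1; split=> //.
  rewrite mulrC -ler_pdivrMr // ltW // (lt_trans (archi_boundP _)) ?ltr_nat //.
  by rewrite divr_ge0 // ltW.
have [D0 lower] := prob_gamma_ge R j0.
exists (324 * j%:R ^+ 2).
have FF : Filter (admissible_oo m d) by exact: within_filter.
apply/cvgrPdist_le => /= e e0.
have [N Ne] : exists N : nat, 3 / e <= N%:R.
  by exists (Num.bound (3 / e)); rewrite ltW // archi_boundP // divr_ge0 // ltW.
move/eqoP: d_small => /(_ 1 ltr01) d_small.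
move/eqoP: delta_large => /(_ 1 ltr01) delta_large.
have {}d_small : \forall n \near admissible_oo m d, (d n)%:R <= Num.sqrt (m n)%:R :> R.
  apply: filterS d_small => n; rewrite mul1r /= => dm.
  by rewrite !ger0_norm ?sqrtr_ge0 in dm.
have {}delta_large : \forall n \near admissible_oo m d,
    2 * Num.sqrt (2 * expR 1) / (d n)%:R
      * (m n)%:R `^ (1 / 2 + 4 / ((d n)%:R + 1) + eps) <= delta (m n).
  apply: filterS delta_large => n /= le.
  apply: le_trans (ler_norm _) (le_trans le _).
  by rewrite mul1r ger0_norm ?(ltW (delta_gt0 _)).
have d_large : \forall n \near admissible_oo m d, (D0 + N + 1 <= d n)%N.
  exact: d_oo (nbhs_infty_ge _).
have even : \forall n \near admissible_oo m d, ~~ odd (n * d n) /\ ~~ odd (m n * d n).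
  exact: withinT.
near=> n.
have [nd_even md_even] : ~~ odd (n * d n) /\ ~~ odd (m n * d n) by near: n.
have mn : (m n <= n)%N by near: n.
have dn : (D0 + N + 1 <= d n)%N by near: n.
have dm : (d n)%:R <= Num.sqrt (m n)%:R :> R by near: n.
have d2m : (d n ^ 2 <= m n)%N.
  rewrite -(ler_nat R) natrX -[leRHS]sqr_sqrtr //.
  by rewrite lerXn2r ?nnegrE ?sqrtr_ge0.
have d0 : (0 < d n)%N by rewrite (leq_trans _ dn) // addn1.
have m0 : (0 < m n)%N by rewrite (leq_trans _ d2m) // expn_gt0 d0.
have md : (m n)%:R ^+ 4 <= delta (m n) ^+ j.
  apply: (expr4_le_exprn d0 m0 dm eps_gt0 epsj).
  by near: n.
have dD : (D0 <= d n)%N by rewrite (leq_trans _ dn) // -addnA leq_addr.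
have := lower n (m n) (d n) (delta (m n)) dD d2m mn nd_even md_even (delta_gt0 _) md.
have := prob_gamma_le1 n (m n) (d n) (delta (m n)) (324 * j%:R ^+ 2).
set p := prob_gamma_le _ _ _ _ _ => p1 pl.
rewrite ger0_norm ?subr_ge0 //.
have : 3 / 2 ^+ (d n) <= e.
  rewrite ler_pdivrMr ?exprn_gt0 // mulrC -ler_pdivrMr //.
  apply: le_trans Ne _; rewrite -natrX ler_nat.
  apply: leq_trans (ltnW (ltn_expl (d n) (ltnSn 1))).
  by rewrite (leq_trans _ dn) // addnAC leq_addl.
lra.
Unshelve. all: by end_near.
Qed.
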